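(* As $\lambda,c\to+\infty$ in such a way that $c^2/\lambda\to 1$, the equation $$\prod_{k=1}^2\left[\left(\frac{\partial}{\partial t}+\lambda\right)^2-c^2\frac{\partial^2}{\partial x_k^2}\right]p-\lambda^{4}p=0$$ converges to the heat equation $$\frac{\partial p}{\partial t}=\frac14\left(\frac{\partial^2}{\partial x_1^2}+\frac{\partial^2}{\partial x_2^2}\right)p.$$ In general, for $d\ge 2$, the equation $$\prod_{k=1}^d\left[\left(\frac{\partial}{\partial t}+\lambda\right)^2-c^2\frac{\partial^2}{\partial x_k^2}\right]p-\lambda^{2d}p=0$$ converges to the heat equation $$\frac{\partial p}{\partial t}=\frac{1}{2d}\Delta p,$$ where the volatility is $\sigma^2=1/d$.
   Context: Here $\lambda>0$ is the rate of the homogeneous Poisson process governing the changes of direction and $c>0$ is the velocity of a cyclic random motion with $2d$ orthogonal directions in $\mathbb{R}^d$; $p=p(x_1,\dots,x_d,t)$ is the unknown function (for the motion, the density of the absolutely continuous component of the distribution of the position at time $t$), and $\Delta=\sum_{k=1}^d\frac{\partial^2}{\partial x_k^2}$ is the Laplacian. *)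

(* Defs.v *)
From HB Require Import structures.
From mathcomp Require Import all_boot all_order all_algebra.
From mathcomp Require Import all_classical all_reals all_analysis.

Set Implicit Arguments.
Unset Strict Implicit.
Unset Printing Implicit Defensive.

Import Order.TTheory GRing.Theory Num.Theory.
Import numFieldNormedType.Exports.

Local Open Scope classical_set_scope.
Local Open Scope ring_scope.

(* A point (x, t) has position x in R^d and time t. *)
Definition spacetime (R : realType) (d : nat) : normedModType R :=
  ('rV[R]_d * R)%type.

Definition operator (R : realType) (d : nat) : Type :=
  (spacetime R d -> R) -> spacetime R d -> R.

(* None is the time direction, Some k the direction of the k-th space
   coordinate. *)
Definition direction (R : realType) (d : nat) (i : option 'I_d) :
    spacetime R d :=
  if i is Some k then (delta_mx 0 k, 0) else (0, 1).

Definition partial (R : realType) (d : nat) (i : option 'I_d) : operator R d :=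
  fun p => 'D_(direction R i) p.

Notation "''d_t' p" := (partial None p) (at level 10, p at next level).
Notation "''d_x[' k ] p" := (partial (Some k) p)
  (at level 10, k at level 200, p at next level, format "''d_x[' k ]  p").

(* The head of w is the outermost derivative. *)
Definition iter_partial (R : realType) (d : nat) (w : seq (option 'I_d)) :
    operator R d :=
  fun p => foldr (@partial R d) p w.

(* p is of class C^n on the open set U. *)
Definition class_C (R : realType) (d n : nat) (U : set (spacetime R d))
    (p : spacetime R d -> R) : Prop :=
  (forall w i z, (size w < n)%N -> U z ->
     derivable (iter_partial w p) z (direction R i)) /\
  (forall w z, (size w <= n)%N -> U z -> {for z, continuous (iter_partial w p)}).

(* Convergence in C^n_loc(U): all derivatives of order at most n converge
   uniformly on the compact subsets of U. *)
Definition cvg_C (R : realType) (d n : nat) (U : set (spacetime R d))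
    (T : Type) (F : set_system T) (p : T -> spacetime R d -> R)
    (q : spacetime R d -> R) : Prop :=
  forall w, (size w <= n)%N ->
    {family compactly_in U, (fun i => iter_partial w (p i)) @ F -->
                            iter_partial w q}.

(* The linear equations L i p = 0, of order at most n, converge along F to the
   equation M p = 0.  Multiplying an equation by a nonzero scalar does not
   change it, so convergence is up to normalising factors mu i.  The operators
   converge on the functions of class C^n: (mu i)(L i)(p i) tends to M q, locally
   uniformly, whenever p i tends to q in C^n_loc.  With a constant family p this
   is the convergence of (mu i)(L i) to M on each function q, hence also of
   each coefficient; when L i (p i) = 0 it says that C^n_loc-limits of solutions
   are solutions of the limit equation. *)
Definition equation_cvg (R : realType) (d n : nat) (T : Type)
    (F : set_system T) (L : T -> operator R d) (M : operator R d) : Prop :=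
  exists mu : T -> R,
    (\forall i \near F, mu i != 0) /\
    forall (U : set (spacetime R d)) (p : T -> spacetime R d -> R)
           (q : spacetime R d -> R),
      open U -> (forall i, class_C n U (p i)) -> class_C n U q ->
      cvg_C n U F p q ->
      {family compactly_in U, (fun i z => mu i * L i (p i) z) @ F --> M q}.

(* d/dt + lambda *)
Definition damped_dt (R : realType) (d : nat) (lambda : R) : operator R d :=
  fun p z => 'd_t p z + lambda * p z.

(* (d/dt + lambda)^2 - c^2 d^2/dx_k^2 *)
Definition factor (R : realType) (d : nat) (lambda c : R) (k : 'I_d) :
    operator R d :=
  fun p z => damped_dt lambda (damped_dt lambda p) z
             - c ^+ 2 * 'd_x[k] ('d_x[k] p) z.

(* The product of the factors is their composition, k = 0 outermost; on
   functions of class C^(2d) the factors commute. *)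
Definition factor_prod (R : realType) (d : nat) (lambda c : R) : operator R d :=
  \big[(fun A B : operator R d => A \o B)/idfun]_(k < d) factor lambda c k.

Definition laplacian (R : realType) (d : nat) : operator R d :=
  fun p z => \sum_(k < d) 'd_x[k] ('d_x[k] p) z.

(* The heat equation of d-dimensional Brownian motion with volatility sigma2
   (variance sigma2 * t of each coordinate at time t) is
   dp/dt = (sigma2 / 2) Laplacian p. *)
Definition brownian_heat (R : realType) (d : nat) (sigma2 : R) : operator R d :=
  fun p z => 'd_t p z - sigma2 / 2 * laplacian p z.

(* Main.v *)
Require Import Defs.
From HB Require Import structures.
From mathcomp Require Import all_boot all_order all_algebra.
From mathcomp Require Import all_classical all_reals all_analysis.
From mathcomp Require Import ring.

Set Implicit Arguments.
Unset Strict Implicit.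
Unset Printing Implicit Defensive.

Import Order.TTheory GRing.Theory Num.Theory.
Import numFieldNormedType.Exports.

Local Open Scope classical_set_scope.
Local Open Scope ring_scope.

(** On functions of class C^2, each factor is a small perturbation of a
    multiple of the identity:
      (d/dt + lambda)^2 - c^2 d_k^2 = lambda^2 (1 + A_k / lambda),
      A_k = 2 d/dt + (1/lambda) d^2/dt^2 - (c^2/lambda) d_k^2.
    As 1/lambda tends to 0 and c^2/lambda tends to 1, A_k tends to
    2 d/dt - d_k^2.  Hence the product of the factors is lambda^(2d) times
    1 + (1/lambda) sum_k A_k + O(1/lambda^2), and
      lambda (lambda^(-2d) prod_k factor_k - 1)
    tends to sum_k (2 d/dt - d_k^2) = 2d d/dt - Laplacian.  Dividing by 2d
    gives the heat operator.

    The product is never expanded.  With V the rescaled product of all factors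
    but the outermost one, the rescaled full product is (1 + A_k / lambda) V, so
      lambda ((1 + A_k / lambda) V p - p) = lambda (V p - p) + A_k (V p).
    By induction the first term converges; therefore V p has the same limit q
    as p, and A_k (V p) tends to 2 dq/dt - d_k^2 q.  This is
    C_cvg_prod_excess.  The induction uses that convergence in C^n_loc is stable
    under sums, under multiplication by convergent scalars, and under
    derivatives, which lower n by one; the two derivatives in A_k are paid for
    by letting n vary in the induction.  Partial derivatives are never
    commuted. *)

(** * Locally uniform convergence *)

Lemma locally_uniformP (R : realType) (V : normedModType R) (U : set V)
    (T : Type) (F : set_system T) {FF : ProperFilter F}
    (f : T -> V -> R) (g : V -> R) :
  {family compactly_in U, f @ F --> g} <->
  forall K, K `<=` U -> compact K -> forall e : R, 0 < e ->
    \forall i \near F, forall z, K z -> `|g z - f i z| < e.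
Proof.
split.
  move=> /fam_cvgP fg K KU cK e e0.
  apply: (fg K (conj KU cK) [set h | forall z, K z -> `|g z - h z| < e]).
  apply/uniform_nbhs.
  exists [set xy : R * R | ball xy.1 e xy.2]; split; last by [].
  exact: entourage_ball (PosNum e0).
move=> fg; apply/fam_cvgP => K [KU cK] P /uniform_nbhs[E [entE EP]].
have [e /= e0 eE] : exists2 e : R, 0 < e &
    [set xy : R * R | ball xy.1 e xy.2] `<=` E.
  by move: entE; rewrite -entourage_ballE => -[e e0 eE]; exists e.
near=> i; apply: EP => z Kz; apply: eE => /=; rewrite /ball /=.
by move: z Kz; near: i; exact: fg.
Unshelve. all: by end_near. Qed.

Lemma locally_uniformD (R : realType) (V : normedModType R) (U : set V)
    (T : Type) (F : set_system T) {FF : ProperFilter F}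
    (f1 f2 : T -> V -> R) (g1 g2 : V -> R) :
  {family compactly_in U, f1 @ F --> g1} ->
  {family compactly_in U, f2 @ F --> g2} ->
  {family compactly_in U, (fun i z => f1 i z + f2 i z) @ F -->
                          (fun z => g1 z + g2 z)}.
Proof.
move=> /locally_uniformP fg1 /locally_uniformP fg2.
apply/locally_uniformP => K KU cK e e0.
have e20 : 0 < e / 2 by rewrite divr_gt0.
near=> i => z Kz.
have h1 : `|g1 z - f1 i z| < e / 2.
  by move: z Kz; near: i; exact: fg1.
have h2 : `|g2 z - f2 i z| < e / 2.
  by move: z Kz {h1}; near: i; exact: fg2.
rewrite opprD addrACA (splitr e) (le_lt_trans (ler_normD _ _)) //.
exact: ltrD.
Unshelve. all: by end_near. Qed.

(** On a compact set the continuous limit g is bounded, so the error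
    b g - a_i f_i = (b - a_i) g + a_i (g - f_i) is uniformly small. *)
Lemma locally_uniformZ (R : realType) (V : normedModType R) (U : set V)
    (T : Type) (F : set_system T) {FF : ProperFilter F}
    (a : T -> R) (b : R) (f : T -> V -> R) (g : V -> R) :
  (forall z, U z -> {for z, continuous g}) ->
  a @ F --> b ->
  {family compactly_in U, f @ F --> g} ->
  {family compactly_in U, (fun i z => a i * f i z) @ F -->
                          (fun z => b * g z)}.
Proof.
move=> cg ab /locally_uniformP fg.
apply/locally_uniformP => K KU cK e e0.
have [M [_ Mg]] : bounded_set (g @` K).
  apply: compact_bounded; apply: continuous_compact => //.
  by apply: continuous_in_subspaceT => z; rewrite inE => /KU /cg.
pose m := `|M| + 1.
have m0 : 0 < m by rewrite /m ltr_wpDl.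
have gm z : K z -> `|g z| <= m.
  move=> Kz; apply: (Mg m); last by exists z.
  by rewrite /m (le_lt_trans (ler_norm M)) // ltrDl.
pose n := `|b| + 1.
have n0 : 0 < n by rewrite /n ltr_wpDl.
near=> i => z Kz.
have ai1 : `|b - a i| < 1 by near: i; move/cvgrPdist_lt : ab; exact.
have ai : `|b - a i| < e / 2 / m.
  by near: i; move/cvgrPdist_lt : ab; apply; rewrite !divr_gt0.
have fi : `|g z - f i z| < e / 2 / n.
  by move: z Kz {ai ai1}; near: i; apply: fg => //; rewrite !divr_gt0.
have an : `|a i| <= n.
  rewrite /n -(subrK b (a i)) (le_trans (ler_normD _ _)) // addrC lerD2l.
  by rewrite distrC ltW.
have -> : b * g z - a i * f i z = (b - a i) * g z + a i * (g z - f i z).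
  by ring.
rewrite (le_lt_trans (ler_normD _ _)) // !normrM (splitr e).
apply: ltr_leD.
  rewrite -(divfK (lt0r_neq0 m0) (e / 2)).
  apply: (le_lt_trans (ler_wpM2l (normr_ge0 _) (gm _ Kz))).
  by rewrite ltr_pM2r.
rewrite -(divfK (lt0r_neq0 n0) (e / 2)) [leRHS]mulrC.
by rewrite ler_pM // ltW.
Unshelve. all: by end_near. Qed.

Lemma locally_uniform_eq (R : realType) (V : normedModType R) (U : set V)
    (T : Type) (F : set_system T) {FF : ProperFilter F}
    (f f' : T -> V -> R) (g g' : V -> R) :
  (forall i z, U z -> f i z = f' i z) -> (forall z, U z -> g z = g' z) ->
  {family compactly_in U, f @ F --> g} ->
  {family compactly_in U, f' @ F --> g'}.
Proof.
move=> ff' gg' /locally_uniformP fg.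
apply/locally_uniformP => K KU cK e e0.
apply: filterS (fg K KU cK e e0) => i fgi z Kz.
by rewrite -ff' -?gg' ?fgi //; exact: KU.
Qed.

(** * Functions of class C^n on an open set *)

(** Derivatives at a point only see the germ of the function there, so identities
    that hold merely on the open set U can be differentiated. *)
Lemma near_eq_on (R : realType) (V : normedModType R) (U : set V)
    (f g : V -> R) z :
  open U -> (forall y, U y -> f y = g y) -> U z -> {near z, f =1 g}.
Proof.
by move=> oU fg Uz; apply: filterS (open_nbhs_nbhs (conj oU Uz)) => y /fg.
Qed.

Lemma iter_partial_eq (R : realType) (d : nat) (U : set (spacetime R d))
    (f g : spacetime R d -> R) w :
  open U -> (forall z, U z -> f z = g z) ->
  forall z, U z -> iter_partial w f z = iter_partial w g z.
Proof.
move=> oU fg; elim: w => //= i w IHw z Uz.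
by apply: near_eq_derive; exact: near_eq_on IHw Uz.
Qed.

Lemma class_C_eq (R : realType) (d n : nat) (U : set (spacetime R d))
    (f g : spacetime R d -> R) :
  open U -> (forall z, U z -> f z = g z) -> class_C n U f -> class_C n U g.
Proof.
move=> oU fg [df cf]; have fgw w := iter_partial_eq w oU fg.
split=> [w i z wn Uz|w z wn Uz].
  exact: near_eq_derivable (near_eq_on oU (fgw w) Uz) (df w i z wn Uz).
rewrite /prop_for /continuous_at -(fgw w z Uz).
exact: cvg_trans (near_eq_cvg (near_eq_on oU (fgw w) Uz)) (cf w z wn Uz).
Qed.

Lemma class_C_le (R : realType) (d m n : nat) (U : set (spacetime R d))
    (f : spacetime R d -> R) :
  (m <= n)%N -> class_C n U f -> class_C m U f.
Proof.
move=> mn [df cf]; split=> [w i z wm|w z wm].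
  exact/df/(leq_trans wm).
exact/cf/(leq_trans wm).
Qed.

Lemma iter_partial_partial (R : realType) (d : nat) (w : seq (option 'I_d)) i
    (f : spacetime R d -> R) :
  iter_partial w (partial i f) = iter_partial (rcons w i) f.
Proof. by rewrite /iter_partial foldr_rcons. Qed.

Lemma class_C_partial (R : realType) (d n : nat) (U : set (spacetime R d)) i
    (f : spacetime R d -> R) :
  class_C n.+1 U f -> class_C n U (partial i f).
Proof.
move=> [df cf]; split=> [w j z wn Uz|w z wn Uz]; rewrite iter_partial_partial.
  by apply: df; rewrite ?size_rcons.
by apply: cf; rewrite ?size_rcons.
Qed.

Lemma iter_partialD (R : realType) (d n : nat) (U : set (spacetime R d))
    (f g : spacetime R d -> R) w :
  open U -> class_C n U f -> class_C n U g -> (size w <= n)%N ->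
  forall z, U z -> iter_partial w (fun z => f z + g z) z =
                   iter_partial w f z + iter_partial w g z.
Proof.
move=> oU [df cf] [dg cg]; elim: w => //= i w IHw wn z Uz.
rewrite [LHS](near_eq_derive _ (near_eq_on oU (IHw (ltnW wn)) Uz)).
by apply: (@deriveD _ _ _ (iter_partial w f)); [exact: df|exact: dg].
Qed.

Lemma class_CD (R : realType) (d n : nat) (U : set (spacetime R d))
    (f g : spacetime R d -> R) :
  open U -> class_C n U f -> class_C n U g ->
  class_C n U (fun z => f z + g z).
Proof.
move=> oU Cf Cg; have [[df cf] [dg cg]] := (Cf, Cg).
have fgw w wn z Uz := esym (@iter_partialD R d n U f g w oU Cf Cg wn z Uz).
split=> [w i z wn Uz|w z wn Uz].
  apply: near_eq_derivable (near_eq_on oU (fgw w (ltnW wn)) Uz) _.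
  by apply: (@derivableD _ _ _ (iter_partial w f)); [exact: df|exact: dg].
rewrite /prop_for /continuous_at -(fgw w wn z Uz).
apply: cvg_trans (near_eq_cvg (near_eq_on oU (fgw w wn) Uz)) _.
by apply: cvgD; [exact: cf|exact: cg].
Qed.

Lemma iter_partialZ (R : realType) (d n : nat) (U : set (spacetime R d))
    (a : R) (f : spacetime R d -> R) w :
  open U -> class_C n U f -> (size w <= n)%N ->
  forall z, U z -> iter_partial w (fun z => a * f z) z =
                   a * iter_partial w f z.
Proof.
move=> oU [df cf]; elim: w => //= i w IHw wn z Uz.
rewrite [LHS](near_eq_derive _ (near_eq_on oU (IHw (ltnW wn)) Uz)).
by apply: (@deriveZ _ _ _ (iter_partial w f)); exact: df.
Qed.

Lemma class_CZ (R : realType) (d n : nat) (U : set (spacetime R d))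
    (a : R) (f : spacetime R d -> R) :
  open U -> class_C n U f -> class_C n U (fun z => a * f z).
Proof.
move=> oU Cf; have [df cf] := Cf.
have fw w wn z Uz := esym (@iter_partialZ R d n U a f w oU Cf wn z Uz).
split=> [w i z wn Uz|w z wn Uz].
  apply: near_eq_derivable (near_eq_on oU (fw w (ltnW wn)) Uz) _.
  by apply: (@derivableZ _ _ _ (iter_partial w f)); exact: df.
rewrite /prop_for /continuous_at -(fw w wn z Uz).
apply: cvg_trans (near_eq_cvg (near_eq_on oU (fw w wn) Uz)) _.
by apply: cvgM; [exact: cvg_cst|exact: cf].
Qed.

(** * Convergence in C^n_loc *)

(** The regularity of the functions is bundled with their convergence because
    derivatives are additive and homogeneous only on differentiable functions:
    the two have to be carried together through every operation. *)
Definition C_cvg (R : realType) (d n : nat) (U : set (spacetime R d))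
    (T : Type) (F : set_system T) (p : T -> spacetime R d -> R)
    (q : spacetime R d -> R) : Prop :=
  [/\ forall i, class_C n U (p i), class_C n U q & cvg_C n U F p q].

Lemma C_cvg_locally_uniform (R : realType) (d n : nat)
    (U : set (spacetime R d)) (T : Type) (F : set_system T)
    (p : T -> spacetime R d -> R) (q : spacetime R d -> R) :
  C_cvg n U F p q -> {family compactly_in U, p @ F --> q}.
Proof. by move=> [_ _ /(_ [::] isT)]. Qed.

Lemma C_cvg_eq (R : realType) (d n : nat) (U : set (spacetime R d))
    (T : Type) (F : set_system T) {FF : ProperFilter F}
    (p p' : T -> spacetime R d -> R) (q q' : spacetime R d -> R) :
  open U -> (forall i z, U z -> p i z = p' i z) ->
  (forall z, U z -> q z = q' z) ->
  C_cvg n U F p q -> C_cvg n U F p' q'.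
Proof.
move=> oU pp' qq' [Cp Cq pq]; split.
- by move=> i; exact: class_C_eq (pp' i) (Cp i).
- exact: class_C_eq qq' Cq.
- move=> w wn; apply: locally_uniform_eq (pq w wn).
    by move=> i; exact: iter_partial_eq oU (pp' i).
  exact: iter_partial_eq oU qq'.
Qed.

Lemma C_cvg_le (R : realType) (d m n : nat) (U : set (spacetime R d))
    (T : Type) (F : set_system T)
    (p : T -> spacetime R d -> R) (q : spacetime R d -> R) :
  (m <= n)%N -> C_cvg n U F p q -> C_cvg m U F p q.
Proof.
move=> mn [Cp Cq pq]; split; [move=> i| |]; try exact: (class_C_le mn).
by move=> w wm; exact: pq _ (leq_trans wm mn).
Qed.

Lemma C_cvg_partial (R : realType) (d n : nat) (U : set (spacetime R d))
    (T : Type) (F : set_system T)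
    (p : T -> spacetime R d -> R) (q : spacetime R d -> R) k :
  C_cvg n.+1 U F p q ->
  C_cvg n U F (fun i => partial k (p i)) (partial k q).
Proof.
move=> [Cp Cq pq]; split; [move=> i| |]; try exact: class_C_partial.
move=> w wn; rewrite iter_partial_partial.
under eq_fun do rewrite iter_partial_partial.
by apply: pq; rewrite size_rcons.
Qed.

Lemma C_cvgD (R : realType) (d n : nat) (U : set (spacetime R d))
    (T : Type) (F : set_system T) {FF : ProperFilter F}
    (p1 p2 : T -> spacetime R d -> R) (q1 q2 : spacetime R d -> R) :
  open U -> C_cvg n U F p1 q1 -> C_cvg n U F p2 q2 ->
  C_cvg n U F (fun i z => p1 i z + p2 i z) (fun z => q1 z + q2 z).
Proof.
move=> oU [Cp1 Cq1 pq1] [Cp2 Cq2 pq2].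
split; [move=> i| |]; try exact: class_CD.
move=> w wn; apply: locally_uniform_eq (locally_uniformD (pq1 w wn) (pq2 w wn)).
  by move=> i z Uz; rewrite (iter_partialD oU (Cp1 i) (Cp2 i) wn).
by move=> z Uz; rewrite (iter_partialD oU Cq1 Cq2 wn).
Qed.

Lemma C_cvgZ (R : realType) (d n : nat) (U : set (spacetime R d))
    (T : Type) (F : set_system T) {FF : ProperFilter F} (a : T -> R) (b : R)
    (p : T -> spacetime R d -> R) (q : spacetime R d -> R) :
  open U -> a @ F --> b -> C_cvg n U F p q ->
  C_cvg n U F (fun i z => a i * p i z) (fun z => b * q z).
Proof.
move=> oU ab [Cp Cq pq]; split; [move=> i| |]; try exact: class_CZ.
move=> w wn; have [_ cq] := Cq.
apply: locally_uniform_eq (locally_uniformZ _ ab (pq w wn)) => //.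
- by move=> i z Uz; rewrite (iter_partialZ _ oU (Cp i) wn).
- by move=> z Uz; rewrite (iter_partialZ _ oU Cq wn).
- by move=> z; exact: cq.
Qed.

(** * The hyperbolic factors *)

Lemma factorE (R : realType) (d : nat) (U : set (spacetime R d))
    (lambda c : R) k (p : spacetime R d -> R) :
  open U -> class_C 2 U p -> forall z, U z ->
  Defs.factor lambda c k p z =
    lambda ^+ 2 * p z + 2 * lambda * 'd_t p z + 'd_t ('d_t p) z
    - c ^+ 2 * 'd_x[k] ('d_x[k] p) z.
Proof.
move=> oU Cp z Uz; have Cp1 : class_C 1 U p by exact: class_C_le Cp.
rewrite /Defs.factor /damped_dt.
have := iter_partialD (w := [:: None]) oU (class_C_partial None Cp)
  (class_CZ lambda oU Cp1) isT Uz.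
have := iter_partialZ (w := [:: None]) lambda oU Cp1 isT Uz.
rewrite /iter_partial /= => -> ->.
(* The derivatives become atoms: comparing them up to conversion diverges. *)
move: ('d_t ('d_t p) z) ('d_t p z) ('d_x[k] ('d_x[k] p) z) (p z) => *.
by ring.
Qed.

(** The operator A_k for which the k-th factor is lambda^2 (1 + A_k / lambda). *)
Definition factor_excess (R : realType) (d : nat) (lambda c : R) (k : 'I_d) :
    operator R d :=
  fun p z => 2 * 'd_t p z + lambda^-1 * 'd_t ('d_t p) z
             - c ^+ 2 / lambda * 'd_x[k] ('d_x[k] p) z.

(** The limit of the operators A_k. *)
Definition factor_limit (R : realType) (d : nat) (k : 'I_d) : operator R d :=
  fun p z => 2 * 'd_t p z - 'd_x[k] ('d_x[k] p) z.

(** The scalar a is there because the inner factors of a product have not been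
    rescaled: a is the power of lambda that they contribute. *)
Lemma factorZ_excess (R : realType) (d : nat) (U : set (spacetime R d))
    (lambda c a : R) k (p : spacetime R d -> R) :
  open U -> class_C 2 U p -> lambda != 0 -> forall z, U z ->
  Defs.factor lambda c k (fun z => a * p z) z =
    a * lambda ^+ 2 * (p z + lambda^-1 * factor_excess lambda c k p z).
Proof.
move=> oU Cp l0 z Uz; rewrite (factorE _ _ _ oU (class_CZ a oU Cp) Uz).
have h w wn := @iter_partialZ R d 2 U a p w oU Cp wn z Uz.
have := h [:: None] isT; have := h [:: None; None] isT.
have := h [:: Some k; Some k] isT.
rewrite /iter_partial /= => -> -> ->; rewrite /factor_excess.
move: ('d_t ('d_t p) z) ('d_t p z) ('d_x[k] ('d_x[k] p) z) (p z) => *.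
by field.
Qed.

Lemma C_cvg_excess (R : realType) (d n : nat) (U : set (spacetime R d))
    (T : Type) (F : set_system T) {FF : ProperFilter F} (lambda c : T -> R)
    (p : T -> spacetime R d -> R) (q : spacetime R d -> R) k :
  open U -> (lambda i)^-1 @[i --> F] --> (0 : R) ->
  c i ^+ 2 / lambda i @[i --> F] --> (1 : R) ->
  C_cvg n.+2 U F p q ->
  C_cvg n U F (fun i => factor_excess (lambda i) (c i) k (p i))
              (factor_limit k q).
Proof.
move=> oU lV r1 pq.
have pt := C_cvg_partial None pq.
have ptt := C_cvg_partial None pt.
have pxx := C_cvg_partial (Some k) (C_cvg_partial (Some k) pq).
have rN1 : - (c i ^+ 2 / lambda i) @[i --> F] --> (-1 : R) by exact: cvgN.
have pt_n := C_cvg_le (leqnSn n) pt.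
apply: C_cvg_eq (C_cvgD oU (C_cvgD oU (C_cvgZ oU (cvg_cst (2 : R)) pt_n)
  (C_cvgZ oU lV ptt)) (C_cvgZ oU rN1 pxx)) => // [i z _|z _].
  by rewrite /factor_excess !mulNr.
by rewrite /factor_limit mul0r addr0 mulN1r.
Qed.

(** Products over an arbitrary sequence of directions, so that the induction can
    remove the outermost factor; factor_prod is the case of all directions. *)
Definition factor_seq (R : realType) (d : nat) (lambda c : R)
    (s : seq 'I_d) : operator R d :=
  \big[(fun A B : operator R d => A \o B)/idfun]_(k <- s)
    Defs.factor lambda c k.

(** The linear term of a product of perturbations of the identity is the sum of
    the linear terms.  Each factor costs two derivatives. *)
Lemma C_cvg_prod_excess (R : realType) (d : nat) (U : set (spacetime R d))
    (T : Type) (F : set_system T) {FF : ProperFilter F} (lambda c : T -> R)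
    (p : T -> spacetime R d -> R) (q : spacetime R d -> R) :
  open U -> (forall i, lambda i != 0) ->
  (lambda i)^-1 @[i --> F] --> (0 : R) ->
  c i ^+ 2 / lambda i @[i --> F] --> (1 : R) ->
  forall (s : seq 'I_d) (n : nat), C_cvg (n + 2 * size s) U F p q ->
  C_cvg n U F
    (fun i z => lambda i *
       ((lambda i ^+ (2 * size s))^-1 *
         factor_seq (lambda i) (c i) s (p i) z - p i z))
    (fun z => \sum_(k <- s) factor_limit k q z).
Proof.
move=> oU l0 lV r1; elim=> [n pq|k s IHs n pq].
  rewrite muln0 addn0 in pq.
  apply: C_cvg_eq (C_cvgZ oU (cvg_cst (0 : R)) pq) => // [i z _|z _].
    by rewrite /factor_seq big_nil muln0 expr0 invr1 mul1r subrr mulr0 mul0r.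
  by rewrite big_nil mul0r.
have pq2 : C_cvg (n.+2 + 2 * size s) U F p q.
  by move: pq; rewrite /= mulnS addnA addn2.
have {}IHs := IHs _ pq2.
pose P i := factor_seq (lambda i) (c i) s (p i).
pose a i := lambda i ^+ (2 * size s).
have a0 i : a i != 0 by rewrite expf_neq0.
pose V i z := (a i)^-1 * P i z.
(* V = p + lambda^-1 (lambda (V - p)), where lambda (V - p) converges. *)
have Vq : C_cvg n.+2 U F V q.
  have pq' : C_cvg n.+2 U F p q by apply: C_cvg_le pq2; exact: leq_addr.
  apply: C_cvg_eq (C_cvgD oU pq' (C_cvgZ oU lV IHs)) => // [i z _|z _].
    by rewrite mulKf // /V addrC subrK.
  by rewrite mul0r addr0.
have n2 : (n <= n.+2)%N by rewrite ltnW.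
apply: C_cvg_eq (C_cvgD oU (C_cvg_excess k oU lV r1 Vq) (C_cvg_le n2 IHs))
  => // [i z Uz|z _]; last by rewrite big_cons.
have [CV _ _] := Vq.
rewrite /factor_seq big_cons /= -/(factor_seq _ _ s) -/(P i).
have -> : P i = fun z => a i * V i z.
  by apply/funext => y; rewrite /V mulVKf.
rewrite (factorZ_excess (c i) _ _ oU _ (l0 i) Uz); last exact: class_C_le (CV i).
rewrite mulnS addnC exprD -/(a i).
rewrite !mulKf ?mulf_neq0 ?expf_neq0 //.
move: (factor_excess _ _ _ _ _) => A.
move: (V i z) (p i z) (lambda i) (l0 i) => v y l l_neq0.
by field.
Qed.

(** * The diffusive limit *)

Lemma sum_factor_limit (R : realType) (d : nat) (q : spacetime R d -> R) z :
  (0 < d)%N ->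
  (2 * d%:R)^-1 * \sum_(k < d) factor_limit k q z =
  'd_t q z - 1 / (2 * d%:R) * laplacian q z.
Proof.
move=> d0; rewrite sumrB sumr_const card_ord -mulr_natl /laplacian.
have : d%:R != 0 :> R by rewrite pnatr_eq0 -lt0n.
by move=> ?; field.
Qed.

Lemma hyperbolic_heat_cvg (R : realType) (T : Type) (F : set_system T)
    {FF : ProperFilter F} (lambda c : T -> R) (d : nat) :
  (0 < d)%N -> (forall i, 0 < lambda i) ->
  lambda i @[i --> F] --> +oo ->
  (c i ^+ 2 / lambda i) @[i --> F] --> (1 : R) ->
  equation_cvg (2 * d) F
    (fun i (p : spacetime R d -> R) z =>
       factor_prod (lambda i) (c i) p z - lambda i ^+ (2 * d) * p z)
    (fun (p : spacetime R d -> R) z =>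
       'd_t p z - 1 / (2 * d%:R) * laplacian p z).
Proof.
move=> d0 l_gt0 l_oo r1.
have l0 i : lambda i != 0 by rewrite gt_eqF.
have lV : (lambda i)^-1 @[i --> F] --> (0 : R).
  by apply/gtr0_cvgV0 => //; near=> i.
have dR0 : 2 * d%:R != 0 :> R by rewrite mulf_neq0 // pnatr_eq0 -lt0n.
(* lambda^(2d) normalises the product to 1 + O(1/lambda); the factor lambda
   then magnifies the linear term, whose limit has 2d as coefficient of d/dt. *)
exists (fun i => (2 * d%:R)^-1 * (lambda i * (lambda i ^+ (2 * d))^-1)); split.
  by near=> i; rewrite !mulf_neq0 ?invr_eq0 // ?expf_neq0.
move=> U p q oU Cp Cq pq.
have sd : size (index_enum 'I_d) = d.
  by rewrite [index_enum _]unlock -enumT size_enum_ord.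
have pq' : C_cvg (0 + 2 * size (index_enum 'I_d)) U F p q.
  by rewrite add0n sd; split.
apply: locally_uniform_eq (C_cvg_locally_uniform (C_cvgZ oU
  (cvg_cst ((2 * d%:R)^-1 : R)) (C_cvg_prod_excess oU l0 lV r1 pq')))
  => [i z _|z _]; last exact: sum_factor_limit.
rewrite sd -[factor_seq _ _ _]/(factor_prod _ _) -!mulrA; congr (_ * (_ * _)).
by rewrite mulrBr mulKf ?expf_neq0.
Unshelve. all: by end_near. Qed.

Theorem mainTheorem8 (R : realType) (T : Type) (F : set_system T)
    (FF : ProperFilter F) (lambda c : T -> R)
    (lambda_gt0 : forall i, 0 < lambda i) (c_gt0 : forall i, 0 < c i)
    (lambda_oo : lambda i @[i --> F] --> +oo)
    (c_oo : c i @[i --> F] --> +oo)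
    (ratio_1 : (c i ^+ 2 / lambda i) @[i --> F] --> (1 : R)) :
  equation_cvg 4 F
    (fun i (p : spacetime R 2 -> R) z =>
       factor_prod (lambda i) (c i) p z - lambda i ^+ 4 * p z)
    (fun (p : spacetime R 2 -> R) z =>
       'd_t p z
       - 1 / 4 * ('d_x[ord0] ('d_x[ord0] p) z
                  + 'd_x[ord_max] ('d_x[ord_max] p) z))
  /\
  forall d : nat, (2 <= d)%N ->
    equation_cvg (2 * d) F
      (fun i (p : spacetime R d -> R) z =>
         factor_prod (lambda i) (c i) p z - lambda i ^+ (2 * d) * p z)
      (fun (p : spacetime R d -> R) z =>
         'd_t p z - 1 / (2 * d%:R) * laplacian p z)
    /\
    (forall (p : spacetime R d -> R) z,
       'd_t p z - 1 / (2 * d%:R) * laplacian p z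
       = brownian_heat (1 / d%:R) p z).
Proof.
have heat d := @hyperbolic_heat_cvg R T F FF lambda c d.
split=> [|d d2]; last first.
  split=> [|p z]; first by apply: heat => //; exact: ltnW.
  by rewrite /brownian_heat !div1r invfM [2^-1 * _]mulrC.
(* The planar equation is the general one for d = 2, with the Laplacian written
   out. *)
have -> : (fun (p : spacetime R 2 -> R) z => 'd_t p z
       - 1 / 4 * ('d_x[ord0] ('d_x[ord0] p) z
                  + 'd_x[ord_max] ('d_x[ord_max] p) z)) =
    (fun p z => 'd_t p z - 1 / (2 * 2%:R) * laplacian p z).
  apply/funext => p; apply/funext => z.
  have -> : 2 * 2%:R = 4 :> R by rewrite -natrM.
  rewrite /laplacian big_ord_recl big_ord1.
  by have -> : lift ord0 ord0 = ord_max :> 'I_2 by exact/val_inj.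
exact: (heat 2).
Qed.
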